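(* Let $G_\phi$ be a signed graph with sink $q$, connected underlying graph $G$, and chip-firing pair $(L,M)=(L_{G_\phi},L_G)$. Let $\vec{s}\in\mathbb{Z}^n$ be the vector with $(\vec{s})_i=1$ if the nonsink vertex $v_i$ is adjacent to $q$ and $(\vec{s})_i=0$ otherwise. Then a configuration $\vec{c}\in S^+$ is critical if and only if $\mathrm{stab}_{S^+}(\vec{c}+LM^{-1}\vec{s})=\vec{c}$.
   Context: A signed graph $G_\phi$ is a finite simple graph $G=(V,E)$ with a sign function $\phi:E\to\{+,-\}$. A vertex $q$ is chosen as sink and $v_1,\dots,v_n$ are the other (nonsink) vertices. The reduced signed Laplacian $L=L_{G_\phi}$ is the $n\times n$ matrix with $L_{ii}=\deg_G(v_i)$ (counting edges to $q$) and, for $i\neq j$, $L_{ij}=-1$ if $v_iv_j$ is a positive edge, $+1$ if it is a negative edge, $0$ if it is not an edge. $M=L_G$ is the same matrix for the all-positive signing. With $G$ connected, both are invertible and $M^{-1}$ has nonnegative entries. The valid configurations are $S^+=\{\vec{c}\in\mathbb{Z}^n: ML^{-1}\vec{c}\ge\vec{0}\}$. For $\vec{c}\in S^+$: site $i$ is ready to fire if $\vec{c}-L\vec{e}_i\in S^+$, and replacing $\vec{c}$ by $\vec{c}-L\vec{e}_i$ is then a legal firing; $\vec{c}$ is stable if no site is ready to fire; $\vec{c}$ is reachable if there is $\vec{d}\in S^+$ at which every site is ready to fire and from which $\vec{c}$ is obtained by a finite sequence of legal firings; $\vec{c}$ is critical if it is stable and reachable. $\mathrm{stab}_{S^+}(\vec{c})$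 denotes the stable configuration obtained from $\vec{c}\in S^+$ by performing legal firings until no site is ready to fire (it exists and is unique). The configuration $\vec{c}+LM^{-1}\vec{s}$ lies in $S^+$ whenever $\vec{c}\in S^+$, so the expression is meaningful. *)

(* Defs.v *)
From Stdlib Require Import Relation_Operators.
From HB Require Import structures.
From mathcomp Require Import all_boot all_order all_algebra.
From mathcomp Require Import boolp classical_sets.
Set Implicit Arguments.
Unset Strict Implicit.
Unset Printing Implicit Defensive.
Import Order.TTheory GRing.Theory Num.Theory.
Local Open Scope ring_scope.

(* The edges are the pairs x, y with sg_adj x y; such an edge is negative if
   sg_neg x y and positive otherwise.  Only the values of sg_neg on edges are
   ever used. *)
Record signed_graph (V : finType) := SignedGraph {
  sg_adj : rel V;
  sg_neg : rel V;
  sg_adj_sym : symmetric sg_adj;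
  sg_adj_irr : irreflexive sg_adj;
  sg_neg_sym : symmetric sg_neg
}.

Definition sg_connected (V : finType) (G : signed_graph V) : Prop :=
  forall x y : V, connect (sg_adj G) x y.

Definition sg_deg (V : finType) (G : signed_graph V) (x : V) : nat :=
  #|[pred y | sg_adj G x y]|.

Definition all_positive (V : finType) (G : signed_graph V) : signed_graph V :=
  @SignedGraph V (sg_adj G) (fun _ _ => false)
    (@sg_adj_sym V G) (@sg_adj_irr V G) (fun _ _ => erefl).

(* v lists the nonsink vertices.  The entries are integers, taken in rat so
   that the matrix can be inverted. *)
Definition reduced_laplacian (V : finType) (G : signed_graph V) (n : nat)
    (v : 'I_n -> V) : 'M[rat]_n :=
  \matrix_(i < n, j < n)
    if i == j then (sg_deg G (v i))%:R
    else if sg_adj G (v i) (v j) then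
      if sg_neg G (v i) (v j) then 1 else -1
    else 0.

Definition sink_vector (V : finType) (G : signed_graph V) (q : V) (n : nat)
    (v : 'I_n -> V) : 'cV[rat]_n :=
  \col_(i < n) (if sg_adj G (v i) q then 1 else 0).

(* Configurations are the integral vectors of 'cV[rat]_n. *)
Definition Splus (n : nat) (L M : 'M[rat]_n) (c : 'cV[rat]_n) : Prop :=
  (forall i : 'I_n, c i 0 \is a Num.int) /\
  (forall i : 'I_n, 0 <= (M *m invmx L *m c) i 0).

(* The notions below are meant for c in Splus L M. *)
Definition fire (n : nat) (L : 'M[rat]_n) (c : 'cV[rat]_n) (i : 'I_n) :
  'cV[rat]_n := c - L *m delta_mx i 0.

Definition ready (n : nat) (L M : 'M[rat]_n) (c : 'cV[rat]_n) (i : 'I_n) :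
  Prop := Splus L M (fire L c i).

Definition legal_firing (n : nat) (L M : 'M[rat]_n) (c d : 'cV[rat]_n) :
  Prop := exists2 i : 'I_n, ready L M c i & d = fire L c i.

Definition legal_firings (n : nat) (L M : 'M[rat]_n) :
  'cV[rat]_n -> 'cV[rat]_n -> Prop :=
  clos_refl_trans 'cV[rat]_n (legal_firing L M).

Definition stable (n : nat) (L M : 'M[rat]_n) (c : 'cV[rat]_n) : Prop :=
  forall i : 'I_n, ~ ready L M c i.

Definition reachable (n : nat) (L M : 'M[rat]_n) (c : 'cV[rat]_n) : Prop :=
  exists d : 'cV[rat]_n,
    [/\ Splus L M d, (forall i : 'I_n, ready L M d i) & legal_firings L M d c].

Definition critical (n : nat) (L M : 'M[rat]_n) (c : 'cV[rat]_n) : Prop :=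
  stable L M c /\ reachable L M c.

(* For the Laplacian pair of a connected signed graph and c in Splus L M, there
   is exactly one such d, so neither the choice nor the default 0 matters. *)
Definition stab (n : nat) (L M : 'M[rat]_n) (c : 'cV[rat]_n) : 'cV[rat]_n :=
  xget 0 (fun d : 'cV[rat]_n => legal_firings L M c d /\ stable L M d).

(* Main.v *)
Require Import Defs.
From Stdlib Require Import Relation_Operators Operators_Properties.
From mathcomp Require Import all_boot all_order all_algebra.
From mathcomp Require Import boolp classical_sets.
From mathcomp Require Import lra.
Set Implicit Arguments.
Unset Strict Implicit.
Unset Printing Implicit Defensive.
Import Order.TTheory GRing.Theory Num.Theory.
Local Open Scope ring_scope.

(** The coordinates [x = M L^-1 c] turn the game into ordinary chip-firing on
nonnegative rational vectors: firing site [i] subtracts column [i] of [M], and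
since [M] has nonpositive off-diagonal entries this is legal exactly when [x i]
is at least [M i i].  Moreover [M 1 = s], so [c + L M^-1 s = c + L 1]: adding
[L M^-1 s] undoes one firing of every site.  The statement is thus Dhar's
burning criterion: a stable [c] is reachable iff the configuration [c + L 1]
can be brought back to [c] by legal firings, each site then firing once.

If [c] is reachable from [d], where every site is ready, stability of [c] forces
every site to fire on the way.  Starting from [c + L 1], the sites fired in the
order of their last firings in that sequence give legal firings down to [c]
([legal_firings_supp], [critical_legal]).

Conversely, suppose [c + L 1] fires down to [c], and let [t >= 0] be integral and
nonzero with [c + L t] valid.  Among the sites where [t] is maximal, the one
that fires first from [c + L 1] is ready at [c + L t], so by induction
[c + L t] fires down to [c] ([burning]).  Since [M^-1 >= 0], some such [t] makes
every coordinate of [M t] so large that every site is ready at [c + L t]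
([saturating_nvec], [legal_critical]).

To pass from legal firings to [stab], stabilization must exist and be unique.
It exists because the sum of the entries of [L^-1 c] is nonnegative on valid
configurations and drops by one at each firing ([stab_exists]); it is unique by
the least action principle ([least_action], [stab_unique]).

Both Laplacians are invertible and [M^-1 >= 0] by the maximum principle on a
connected graph ([subharmonic_le]). *)

(** * Chip-firing for an abstract pair *)

(** The properties of the two Laplacians on which the chip-firing arguments
rest: [M] is a nonsingular M-matrix with nonnegative row sums. *)
Record chip_firing_pair (n : nat) (L M : 'M[rat]_n) : Prop := {
  pair_L_unit : L \in unitmx;
  pair_L_int : forall i j, L i j \is a Num.int;
  pair_M_unit : M \in unitmx;
  pair_M_offdiag : forall i j, i != j -> M i j <= 0;
  pair_M_rowsum : forall i, 0 <= \sum_j M i j;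
  pair_M_inv : forall i j, 0 <= invmx M i j
}.

Section Pair.
Variables (n : nat) (L M : 'M[rat]_n).
Hypothesis LM : chip_firing_pair L M.
Implicit Types (c d : 'cV[rat]_n) (u t : 'I_n -> nat) (i j : 'I_n).

Local Notation one := (const_mx 1 : 'cV[rat]_n).

(** Firing vectors: [u i] counts the firings of site [i]. *)
Definition nvec u : 'cV[rat]_n := \col_i (u i)%:R.

(** The coordinates in which the game is ordinary chip-firing: [c] is valid when
[chips c] is nonnegative. *)
Definition chips c : 'cV[rat]_n := M *m invmx L *m c.

Lemma chips_add c w i :
  chips (c + L *m w) i 0 = chips c i 0 + (M *m w) i 0.
Proof.
rewrite /chips mulmxDr mulmxA mulmxKV ?(pair_L_unit LM) //.
by rewrite [LHS]mxE.
Qed.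

Lemma chips_sub c w i :
  chips (c - L *m w) i 0 = chips c i 0 - (M *m w) i 0.
Proof. by rewrite -mulmxN chips_add mulmxN [X in _ + X = _]mxE. Qed.

Lemma chips_fire c i j : chips (fire L c i) j 0 = chips c j 0 - M j i.
Proof.
by rewrite /fire chips_sub -colE [X in _ - X]mxE.
Qed.

Lemma mulmx_nvec (A : 'M[rat]_n) u i :
  (A *m nvec u) i 0 = \sum_j A i j * (u j)%:R.
Proof. by rewrite mxE; apply: eq_bigr => j _; rewrite mxE. Qed.

Lemma mulmx_nvec_int u i : (L *m nvec u) i 0 \is a Num.int.
Proof.
rewrite mulmx_nvec rpred_sum // => j _.
by rewrite rpredM ?rpred_nat // (pair_L_int LM).
Qed.

Lemma nvec_add1 u i : nvec (fun j => u j + (j == i))%N = nvec u + delta_mx i 0.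
Proof. by apply/colP => j; rewrite !mxE eqxx andbT natrD. Qed.

Lemma nvec_sub1 u i : (0 < u i)%N ->
  nvec u = nvec (fun j => u j - (j == i))%N + delta_mx i 0.
Proof.
move=> ui; apply/colP => j; rewrite !mxE eqxx andbT -natrD subnK //.
by case: eqP => [->|].
Qed.

Lemma nvec0 u : (forall i, u i = 0%N) -> nvec u = 0.
Proof. by move=> u0; apply/colP => i; rewrite !mxE u0. Qed.

Lemma nvec1 : nvec (fun=> 1%N) = one.
Proof. by apply/colP => i; rewrite !mxE. Qed.

Lemma mulmx_L_inj (w1 w2 : 'cV[rat]_n) : L *m w1 = L *m w2 -> w1 = w2.
Proof. by move/(congr1 (mulmx (invmx L))); rewrite !mulKmx ?(pair_L_unit LM). Qed.

Lemma nvec_add0 u t : nvec u + nvec t = 0 -> nvec u = 0.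
Proof.
move=> /colP ut; apply/colP => i; have := ut i.
by rewrite !mxE => /eqP; rewrite -natrD pnatr_eq0 addn_eq0 => /andP[/eqP->].
Qed.

Lemma fire_add c w i : fire L (c + L *m (w + delta_mx i 0)) i = c + L *m w.
Proof. by rewrite /fire mulmxDr addrA addrK. Qed.

Lemma fireK c i : fire L c i + L *m delta_mx i 0 = c.
Proof. by rewrite /fire subrK. Qed.

(** Firing [i] can only increase the other coordinates, so the fired site alone
decides whether the firing is legal. *)
Lemma ready_site c i : Splus L M c -> 0 <= chips (fire L c i) i 0 ->
  ready L M c i.
Proof.
move=> [c_int c_ge0] ci; split=> j.
  by rewrite /fire -colE !mxE rpredB // (pair_L_int LM).
have [->//|ji] := eqVneq j i.
change (0 <= chips (fire L c i) j 0); rewrite chips_fire.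
by rewrite subr_ge0 (le_trans (pair_M_offdiag LM ji)) // c_ge0.
Qed.

(** A site that does not fire only receives chips. *)
Lemma mulmx_M_idle u i : u i = 0%N -> (M *m nvec u) i 0 <= 0.
Proof.
move=> ui; rewrite mulmx_nvec sumr_le0 // => j _.
have [<-|ij] := eqVneq i j; first by rewrite ui mulr0.
by rewrite mulr_le0_ge0 // (pair_M_offdiag LM).
Qed.

(** Induction on a firing sequence with fixed end, one first firing at a time. *)
Lemma legal_firings_ind1 (P : 'cV[rat]_n -> Prop) d :
  P d ->
  (forall c i, ready L M c i -> legal_firings L M (fire L c i) d ->
     P (fire L c i) -> P c) ->
  forall c, legal_firings L M c d -> P c.
Proof.
move=> Pd Pstep c /clos_rt_rt1n_iff cd.
elim: cd Pd Pstep => // {}c _ {}d [i ci ->] /clos_rt_rt1n_iff cd IH Pd Pstep.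
by apply: (Pstep c i) => //; apply: IH.
Qed.

Lemma legal_firings_step c i d : ready L M c i ->
  legal_firings L M (fire L c i) d -> legal_firings L M c d.
Proof. by move=> ci; apply: rt_trans; apply: rt_step; exists i. Qed.

Lemma legal_firings_vec c d : legal_firings L M c d ->
  exists u, c = d + L *m nvec u.
Proof.
move: c; apply: legal_firings_ind1.
  by exists (fun=> 0%N); rewrite nvec0 // mulmx0 addr0.
move=> c i _ _ [u cu]; exists (fun j => u j + (j == i))%N.
by rewrite nvec_add1 mulmxDr addrA -cu fireK.
Qed.

(** Legal firings never overshoot: if the firing vector [u] leads to a stable
configuration, a site that still has to fire legally must fire in [u] too,
since otherwise it would be ready in the end.  So every legal sequence uses up
only a part of [u], and [w] is what remains. *)
Lemma least_action c d u : legal_firings L M c d ->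
  Splus L M (c - L *m nvec u) -> stable L M (c - L *m nvec u) ->
  exists w, c - L *m nvec u = d - L *m nvec w.
Proof.
move=> cd; move: c cd u; apply: legal_firings_ind1; first by move=> u; exists u.
move=> c i ci _ IH u Su stu.
have [ui|ui] := posnP (u i).
  case: (stu i); apply: ready_site => //.
  rewrite chips_fire chips_sub.
  have := mulmx_M_idle ui; have := ci.2 i.
  rewrite -/(chips _) chips_fire; lra.
have e : c - L *m nvec u =
         fire L c i - L *m nvec (fun j => u j - (j == i))%N.
  by rewrite (nvec_sub1 ui) mulmxDr opprD /fire addrA addrAC.
by rewrite e in Su stu *; apply: IH.
Qed.

Lemma Splus_legal_firings c d :
  Splus L M c -> legal_firings L M c d -> Splus L M d.
Proof. by move=> + cd; elim: cd => [x _ [i xi ->]||x y z _ IHxy _ IHyz]; auto. Qed.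

(** By least action the firing vectors leading to two stabilizations bound each
other. *)
Lemma stab_unique c d1 d2 : Splus L M c ->
  legal_firings L M c d1 -> stable L M d1 ->
  legal_firings L M c d2 -> stable L M d2 -> d1 = d2.
Proof.
have least d d' : Splus L M c -> legal_firings L M c d ->
    legal_firings L M c d' -> stable L M d' ->
    exists w, d' = d - L *m nvec w.
  move=> Sc cd cd' st'; have [u cu] := legal_firings_vec cd'.
  have d'E : d' = c - L *m nvec u by rewrite cu addrK.
  rewrite d'E; apply: least_action => //; rewrite -d'E //.
  exact: Splus_legal_firings cd'.
move=> Sc cd1 st1 cd2 st2.
have [w1 e1] := least _ _ Sc cd1 cd2 st2.
have [w2 e2] := least _ _ Sc cd2 cd1 st1.
have /nvec_add0 w0 : nvec w1 + nvec w2 = 0.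
  apply: mulmx_L_inj; rewrite mulmx0 mulmxDr.
  by move: e2; rewrite e1 -addrA -[LHS]addr0 => /addrI/esym/eqP;
    rewrite -opprD oppr_eq0 => /eqP.
by rewrite e1 w0 mulmx0 subr0.
Qed.

(** In the coordinates [L^-1 c = M^-1 (chips c)] a firing subtracts a unit vector,
and these coordinates stay nonnegative because [M^-1] is. *)
Lemma stab_exists c : Splus L M c ->
  exists d, legal_firings L M c d /\ stable L M d.
Proof.
pose weight c := \sum_i (invmx L *m c) i 0.
have weight_ge0 d : Splus L M d -> 0 <= weight d.
  move=> [_ d_ge0]; apply: sumr_ge0 => i _.
  rewrite -[invmx L *m d](mulKmx (pair_M_unit LM)) mxE.
  apply: sumr_ge0 => j _; rewrite mulr_ge0 ?(pair_M_inv LM) // mulmxA.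
  exact: d_ge0.
have weight_fire d i : weight (fire L d i) = weight d - 1.
  rewrite /weight /fire (eq_bigr (fun j => (invmx L *m d) j 0 - (j == i)%:R)).
    rewrite sumrB; congr (_ - _).
    by rewrite (bigD1 i) //= eqxx big1 ?addr0 // => j /negPf->.
  move=> j _; rewrite mulmxBr mulKmx ?(pair_L_unit LM) // mxE; congr (_ + _).
  by rewrite !mxE eqxx andbT.
move=> Sc; have [k] : exists k : nat, weight c < k%:R.
  exists (Num.truncn (weight c)).+1.
  by have /andP[] := Num.Theory.truncn_itv (weight_ge0 _ Sc).
elim: k c Sc => [|k IH] c Sc ck; first by have := weight_ge0 _ Sc; lra.
have [st|/existsNP[i /contrapT ci]] := EM (stable L M c).
  by exists c; split=> //; apply: rt_refl.
have [|d [cd st]] := IH (fire L c i) ci.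
  by rewrite weight_fire; move: ck; rewrite mulrSr; lra.
by exists d; split=> //; apply: legal_firings_step cd.
Qed.

Lemma stabP c d : Splus L M c ->
  stab L M c = d <-> legal_firings L M c d /\ stable L M d.
Proof.
move=> Sc; split=> [<-|[cd st]].
  exact: (xgetPex 0 (stab_exists Sc)).
apply: xget_subset1 => // d1 d2 [cd1 st1] [cd2 st2].
exact: (stab_unique Sc).
Qed.

Definition supp u i : nat := (0 < u i)%N.

(** On the support of [t] the increment of [chips] is at least a row sum of [M],
which is nonnegative;
off the support it only gets larger when the positive values of [t] are lowered
to [1]. *)
Lemma Splus_supp c t : Splus L M c -> Splus L M (c + L *m nvec t) ->
  Splus L M (c + L *m nvec (supp t)).
Proof.
move=> [c_int c_ge0] [_ ct_ge0]; split=> i.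
  by rewrite mxE rpredD // mulmx_nvec_int.
change (0 <= chips (c + L *m nvec (supp t)) i 0).
rewrite chips_add mulmx_nvec.
have [ti|ti] := posnP (t i).
  have := ct_ge0 i; rewrite -/(chips _) chips_add mulmx_nvec => /le_trans; apply.
  rewrite lerD2l ler_sum // => j _.
  have [<-|ij] := eqVneq i j; first by rewrite /supp ti.
  by rewrite ler_wnM2l ?(pair_M_offdiag LM) // ler_nat /supp; case: (t j).
rewrite addr_ge0 //.
apply: le_trans (pair_M_rowsum LM i) _; apply: ler_sum => j _.
have [<-|ij] := eqVneq i j; first by rewrite /supp ti mulr1.
rewrite -[leLHS]mulr1 ler_wnM2l ?(pair_M_offdiag LM) //.
by rewrite /supp; case: (t j).
Qed.

(** Keep of each site only its last firing: [supp t] records which sites still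
fire, and prepending a firing of [i] to the sequence changes [supp t] only if
[i] never fires again.  Legality of the shortened sequence is [Splus_supp]. *)
Lemma legal_firings_supp c d : Splus L M c -> legal_firings L M d c ->
  exists t, d = c + L *m nvec t /\
    legal_firings L M (c + L *m nvec (supp t)) c.
Proof.
move=> Sc; move: d; apply: legal_firings_ind1.
  exists (fun=> 0%N); rewrite !nvec0 // mulmx0 addr0; split=> //.
  exact: rt_refl.
move=> d i di _ [t [dt t_legal]]; exists (fun j => t j + (j == i))%N; split.
  by rewrite nvec_add1 mulmxDr addrA -dt fireK.
have [ti|ti] := posnP (t i); last first.
  congr (legal_firings _ _ (_ + _ *m _) _): t_legal; apply/colP => j.
  by rewrite !mxE /supp; case: eqP => [->|_]; rewrite ?addn0 // addn1 ti.
have suppE : nvec (supp (fun j => t j + (j == i))%N) =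
             nvec (supp t) + delta_mx i 0.
  rewrite -nvec_add1; apply/colP => j; rewrite !mxE /supp.
  by case: eqP => [->|_]; rewrite ?addn0 // ti.
rewrite suppE; apply: (@legal_firings_step _ i); rewrite ?fire_add //.
rewrite /ready fire_add; apply: Splus_supp => //.
by rewrite -dt.
Qed.

(** A site that is ready at the start and never fires stays ready.  So, [c] being
stable, every site fires on the way from a configuration where all are ready,
and keeping the last firings leaves exactly one firing of each site. *)
Lemma critical_legal c : Splus L M c -> critical L M c ->
  legal_firings L M (c + L *m one) c.
Proof.
move=> Sc [st [d [Sd d_ready dc]]].
have [t [dt]] := legal_firings_supp Sc dc.
rewrite -nvec1; congr (legal_firings _ _ (_ + _ *m nvec _) _).
apply/funext => i; rewrite /supp; have [ti|//] := posnP (t i).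
case: (st i); apply: ready_site => //.
have := (d_ready i).2 i; rewrite -/(chips _) !chips_fire dt chips_add.
have := mulmx_M_idle ti; lra.
Qed.

(** In a firing sequence from [c + L u] to [c], [i] is the first site of [A] to
fire and [u'] counts the firings still to come just before that. *)
Lemma first_firing c u (A : pred 'I_n) i0 :
  A i0 -> (forall i, A i -> 0 < u i)%N ->
  legal_firings L M (c + L *m nvec u) c ->
  exists i u', [/\ A i, forall j, A j -> u' j = u j, forall j, (u' j <= u j)%N
    & ready L M (c + L *m nvec u') i].
Proof.
move=> Ai0 uA; move yE: (c + _) => y yc.
move: y yc u yE uA; apply: legal_firings_ind1.
  move=> u; rewrite -[RHS]addr0 => /addrI; rewrite -[RHS](mulmx0 _ L).
  move=> /mulmx_L_inj/colP/(_ i0); rewrite !mxE => /eqP.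
  by rewrite pnatr_eq0 => /eqP ui0 /(_ _ Ai0); rewrite ui0.
move=> y i yi yc IH u yE uA.
have [Ai|nAi] := boolP (A i).
  by exists i, u; split=> //; rewrite yE.
have [w wE] := legal_firings_vec yc.
have uE : nvec u = nvec (fun j => w j + (j == i))%N.
  apply: mulmx_L_inj; apply: (addrI c).
  by rewrite yE nvec_add1 mulmxDr addrA -wE fireK.
have {}uE j : u j = (w j + (j == i))%N.
  by apply/eqP; move/colP/(_ j): uE; rewrite !mxE => /eqP; rewrite eqr_nat.
have [||k [u' [Ak u'A u'le rk]]] := IH w; first by rewrite wE.
  move=> j Aj; have := uA j Aj; rewrite uE.
  by case: eqP Aj nAi => [->->|]; rewrite ?addn0.
exists k, u'; split=> // j.
  by move=> Aj; rewrite u'A // uE; case: eqP Aj nAi => [->->|]; rewrite ?addn0.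
by rewrite uE (leq_trans (u'le j)) // leq_addr.
Qed.

(** Let [i] be the first site to fire from [c + L 1] among those where [t] is
maximal, and [u] the indicator of the sites still to fire then.  All entries of
[t - u] are at most its entry [max t - 1] at [i], so [chips (c + L t)] exceeds
[chips (c + L u)] at [i] by at least [max t - 1] times a row sum of [M];
hence [i] is ready at [c + L t]. *)
Lemma burning c t : Splus L M c ->
  legal_firings L M (c + L *m one) c ->
  Splus L M (c + L *m nvec t) -> legal_firings L M (c + L *m nvec t) c.
Proof.
move=> Sc burn; have [k] := ubnP (\sum_i t i)%N; elim: k t => // k IH t tk St.
have [/existsP[i0 ti0]|/existsPn t0] := boolP [exists i, 0 < t i]%N; last first.
  rewrite nvec0 ?mulmx0 ?addr0; first exact: rt_refl.
  by move=> i; apply/eqP; have := t0 i; rewrite -eqn0Ngt.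
case: (@arg_maxnP _ i0 predT t isT) => a _ amax.
have ta : (0 < t a)%N by apply: leq_trans ti0 (amax i0 isT).
rewrite -nvec1 in burn.
have [//|i [u [/eqP ti uA u1 ri]]] :=
  @first_firing c (fun=> 1%N) [pred i | t i == t a] a (eqxx _) _ burn.
have {}ri : ready L M (c + L *m nvec t) i.
  apply: ready_site => //; have := ri.2 i.
  rewrite -/(chips _) !chips_fire !chips_add !mulmx_nvec => /le_trans; apply.
  rewrite lerB // lerD2l -subr_ge0 -sumrB.
  apply: le_trans (_ : 0 <= \sum_j M i j * (t a).-1%:R) _.
    by rewrite -mulr_suml mulr_ge0 ?(pair_M_rowsum LM).
  apply: ler_sum => j _; rewrite -mulrBr.
  have [<-|ij] := eqVneq i j.
    rewrite uA /= ?ti ?eqxx // -[X in X%:R - _](prednK ta).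
    by rewrite mulrSr addrK.
  apply: ler_wnM2l; first exact: (pair_M_offdiag LM).
  rewrite lerBlDr -natrD ler_nat.
  have [tj|tj] := eqVneq (t j) (t a).
    by rewrite uA /= ?tj // addn1 prednK.
  apply: leq_trans (leq_addr _ _); rewrite -ltnS prednK //.
  by rewrite ltn_neqAle tj; apply: amax.
have ti0' : (0 < t i)%N by rewrite ti.
apply: (legal_firings_step ri).
have tE := nvec_sub1 ti0'.
move: ri; rewrite /ready tE fire_add => St'; apply: IH => //.
rewrite ltnS in tk; apply: leq_trans tk.
rewrite (bigD1 i) //= [ltnRHS](bigD1 i) //= eqxx.
rewrite (eq_bigr t) => [|j /negPf->]; last by rewrite subn0.
by rewrite -addSn leq_add2r subn1 prednK.
Qed.

(** A large integral multiple of [M^-1 1] works, once denominators are cleared. *)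
Lemma saturating_nvec :
  exists t, forall i, 0 <= (M *m nvec t) i 0 /\ M i i <= (M *m nvec t) i 0.
Proof.
pose w := invmx M *m one.
have w_ge0 i : 0 <= w i 0.
  by rewrite mxE sumr_ge0 // => j _; rewrite mxE mulr1 (pair_M_inv LM).
pose D : int := \prod_i denq (w i 0).
have D_gt0 : 0 < D by rewrite prodr_gt0 // => i _; rewrite denq_gt0.
have Dw_nat i : D%:~R * w i 0 \is a Num.nat.
  rewrite natrEint mulr_ge0 ?ler0z ?(ltW D_gt0) // andbT.
  rewrite /D (bigD1 i) //= intrM mulrAC [_ * w i 0]mulrC.
  by rewrite rpredM ?intr_int // -numqE intr_int.
(* [K] bounds every diagonal entry of [M], and [D] clears denominators. *)
pose K := (\sum_i (Num.truncn `|M i i|).+1)%N.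
pose a i := Num.truncn (D%:~R * w i 0).
exists (fun i => K * a i)%N => i.
have -> : nvec (fun i => K * a i)%N = (K%:R * D%:~R) *: w.
  by apply/colP => j; rewrite [LHS]mxE [RHS]mxE natrM truncnK // mulrA.
rewrite -scalemxAr mulKVmx ?(pair_M_unit LM) // !mxE mulr1; split.
  by rewrite mulr_ge0 // ler0z ltW.
apply: le_trans (_ : K%:R <= _); last by rewrite ler_peMr // ler1z.
apply: le_trans (ler_norm _) _.
apply: le_trans (_ : ((Num.truncn `|M i i|).+1)%:R <= _).
  by rewrite ltW // truncnS_gt.
by rewrite ler_nat /K (bigD1 i) //= leq_addr.
Qed.

(** The configuration with every site ready that witnesses reachability is
[c + L t] for a saturating [t]. *)
Lemma legal_critical c : Splus L M c -> stable L M c ->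
  legal_firings L M (c + L *m one) c -> critical L M c.
Proof.
move=> Sc st burn; split=> //.
have [t Mt] := saturating_nvec.
have St : Splus L M (c + L *m nvec t).
  split=> i; first by rewrite mxE rpredD ?mulmx_nvec_int // Sc.1.
  change (0 <= chips (c + L *m nvec t) i 0).
  by rewrite chips_add addr_ge0 ?(Mt i).1 //; apply: Sc.2.
exists (c + L *m nvec t); split=> // [i|]; last exact: burning.
apply: ready_site => //; rewrite chips_fire chips_add -addrA addr_ge0 //.
  exact: Sc.2.
by rewrite subr_ge0 (Mt i).2.
Qed.

Theorem critical_iff_stab c : Splus L M c ->
  critical L M c <-> stab L M (c + L *m one) = c.
Proof.
move=> Sc; have S1 : Splus L M (c + L *m one).
  split=> i; first by rewrite mxE rpredD ?Sc.1 // -nvec1 mulmx_nvec_int.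
  change (0 <= chips (c + L *m one) i 0).
  rewrite chips_add addr_ge0 //; first exact: Sc.2.
  rewrite mxE (eq_bigr (M i)) ?(pair_M_rowsum LM) // => j _.
  by rewrite mxE mulr1.
rewrite (stabP _ S1); split=> [crit|[]].
  by split; [apply: critical_legal | apply: crit.1].
by move=> burn st; apply: legal_critical.
Qed.

End Pair.

(** * The Laplacian pair of a connected signed graph *)

Lemma unitmx_inj n (A : 'M[rat]_n) :
  (forall h : 'cV[rat]_n, A *m h = 0 -> h = 0) -> A \in unitmx.
Proof.
move=> A_inj; rewrite -unitmx_tr -row_free_unit; apply: inj_row_free => w.
move/(congr1 trmx); rewrite trmx_mul trmxK trmx0 => /A_inj.
by move/(congr1 trmx); rewrite trmxK trmx0.
Qed.

(** Maximum principle: away from [q] every neighbor of a maximum point is again a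
maximum point, so by connectivity the maximum propagates to [q]. *)
Lemma subharmonic_le (V : finType) (G : signed_graph V) (q : V)
    (f : V -> rat) :
  sg_connected G ->
  (forall x, x != q ->
     (sg_deg G x)%:R * f x <= \sum_(y | sg_adj G x y) f y) ->
  forall x, f x <= f q.
Proof.
move=> G_conn f_sub x.
case: (@arg_maxP _ _ _ q predT f isT) => m _ m_max.
have f_max y : f y <= f m by apply: m_max.
suff fq : f q = f m by rewrite fq f_max.
apply/eqP; apply/contraT => fq.
suff level : closed (sg_adj G) [pred y | f y == f m].
  by have := closed_connect level (G_conn m q); rewrite !inE eqxx (negPf fq).
apply: intro_closed; first exact/sym_connect_sym/sg_adj_sym.
move=> y z yz; rewrite !inE => /eqP fy.
have yq : y != q by apply: contraNneq fq => <-; rewrite fy.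
have := f_sub y yq; rewrite fy mulr_natl /sg_deg -sumr_const -subr_ge0 -sumrB.
rewrite (bigD1 z) //= => sum_ge0.
rewrite eq_le f_max //= -subr_ge0; apply: le_trans sum_ge0 _.
rewrite gerDl sumr_le0 // => w _.
by rewrite subr_le0 f_max.
Qed.

Section ReducedLaplacian.
Variables (V : finType) (G : signed_graph V) (q : V) (n : nat) (v : 'I_n -> V).
Hypothesis v_inj : injective v.
Hypothesis v_nonsink : forall x : V, (x \in codom v) = (x != q).
Hypothesis G_conn : sg_connected G.

Lemma sum_nonsink (P : pred V) (g : V -> rat) :
  \sum_(y | P y) g y = (if P q then g q else 0) + \sum_(j | P (v j)) g (v j).
Proof.
rewrite big_mkcond (bigD1 q) //=; congr (_ + _).
rewrite [RHS]big_mkcond (eq_bigl (mem (v @: [set: 'I_n]))).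
  rewrite big_imset; last by move=> i j _ _; apply: v_inj.
  by apply: eq_bigl => j; rewrite inE.
move=> y; rewrite -v_nonsink.
by apply/codomP/imsetP => [[i ->]|[i _ ->]]; exists i.
Qed.

(** The maximum principle for functions on the nonsink vertices, extended by
[0] at the sink. *)
Lemma nonsink_subharmonic_le0 (h : 'I_n -> rat) :
  (forall i, (sg_deg G (v i))%:R * h i <=
     \sum_(j | sg_adj G (v i) (v j)) h j) ->
  forall i, h i <= 0.
Proof.
move=> h_sub i.
pose f x := \sum_(j | v j == x) h j.
have fv j : f (v j) = h j.
  by rewrite /f (eq_bigl (pred1 j)) ?big_pred1_eq // => k; rewrite (inj_eq v_inj).
have fq : f q = 0.
  rewrite /f big_pred0 // => j; apply/negbTE.
  by rewrite -v_nonsink codom_f.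
rewrite -fv -fq; apply: (subharmonic_le G_conn) => x; rewrite -v_nonsink.
move=> /codomP[j ->]; rewrite fv sum_nonsink fq if_same add0r.
by rewrite (eq_bigr _ (fun j _ => fv j)).
Qed.

Lemma reduced_laplacian_mul (H : signed_graph V) (h : 'cV[rat]_n) i :
  (reduced_laplacian H v *m h) i 0 = (sg_deg H (v i))%:R * h i 0 +
    \sum_(j | sg_adj H (v i) (v j))
      (if sg_neg H (v i) (v j) then 1 else -1) * h j 0.
Proof.
rewrite mxE (bigD1 i) //= mxE eqxx; congr (_ + _).
rewrite big_mkcond [RHS]big_mkcond /=; apply: eq_bigr => j _; rewrite mxE.
have [->|ij] := eqVneq i j; first by rewrite sg_adj_irr.
by case: ifP => // _; rewrite mul0r.
Qed.

Let L := reduced_laplacian G v.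
Let M := reduced_laplacian (all_positive G) v.

Lemma positive_laplacian_mul (h : 'cV[rat]_n) i :
  (M *m h) i 0 =
  (sg_deg G (v i))%:R * h i 0 - \sum_(j | sg_adj G (v i) (v j)) h j 0.
Proof.
rewrite reduced_laplacian_mul -sumrN; congr (_ + _).
by apply: eq_bigr => j _; rewrite mulN1r.
Qed.

Lemma positive_laplacian_ge0 (h : 'cV[rat]_n) :
  (forall i, 0 <= (M *m h) i 0) -> forall i, 0 <= h i 0.
Proof.
move=> Mh i; rewrite -oppr_le0.
apply: (nonsink_subharmonic_le0 (h := fun i => - h i 0)) => j.
by have := Mh j; rewrite positive_laplacian_mul sumrN mulrN subr_ge0 lerN2.
Qed.

Lemma positive_laplacian_unit : M \in unitmx.
Proof.
apply: unitmx_inj => h Mh; apply/colP => i; apply/eqP.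
rewrite mxE eq_le -[h i 0 <= 0]oppr_ge0 andbC positive_laplacian_ge0 /=.
  have -> : - h i 0 = (- h) i 0 by rewrite mxE.
  by apply: positive_laplacian_ge0 => j; rewrite mulmxN Mh oppr0 mxE.
by move=> j; rewrite Mh mxE.
Qed.

(** A kernel vector has an absolute value that is subharmonic, whatever the signs
of the edges. *)
Lemma signed_laplacian_unit : L \in unitmx.
Proof.
apply: unitmx_inj => h Lh; apply/colP => i; apply/eqP.
rewrite mxE -normr_le0.
apply: (nonsink_subharmonic_le0 (h := fun i => `|h i 0|)) => j.
have /eqP := reduced_laplacian_mul G h j.
rewrite -/L Lh mxE eq_sym addr_eq0 => /eqP e.
rewrite -[X in X * _]normr_nat -normrM e normrN.
apply: le_trans (ler_norm_sum _ _ _) _; apply: ler_sum => k _.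
by rewrite normrM; case: ifP => _; rewrite ?normrN normr1 mul1r.
Qed.

(** The row sum at a vertex counts its edges to the sink. *)
Lemma positive_laplacian1 : M *m const_mx 1 = sink_vector G q v.
Proof.
apply/colP => i; rewrite positive_laplacian_mul !mxE mulr1 /sg_deg.
rewrite -sumr_const sum_nonsink [X in _ - X](eq_bigr (fun=> 1)); last first.
  by move=> j _; rewrite mxE.
by rewrite addrK.
Qed.

Lemma laplacian_pair : chip_firing_pair L M.
Proof.
split.
- exact: signed_laplacian_unit.
- move=> i j; rewrite mxE; do ![case: ifP => _];
    by rewrite ?rpredN ?rpred_nat ?rpred1 ?rpred0.
- exact: positive_laplacian_unit.
- by move=> i j ij; rewrite mxE (negPf ij); case: ifP.
- move=> i; have := congr1 (fun w : 'cV_n => w i 0) positive_laplacian1.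
  rewrite mxE [RHS]mxE.
  under eq_bigr do rewrite [const_mx _ _ _]mxE mulr1.
  by move=> ->; case: ifP.
- move=> i j; have := positive_laplacian_ge0 (h := col j (invmx M)) _ i.
  rewrite mxE; apply=> k.
  by rewrite colE mulKVmx ?positive_laplacian_unit // mxE.
Qed.

End ReducedLaplacian.

Theorem proposition3p11 (V : finType) (G : signed_graph V) (q : V) (n : nat)
    (v : 'I_n -> V) (v_inj : injective v)
    (v_nonsink : forall x : V, (x \in codom v) = (x != q))
    (G_conn : sg_connected G) (c : 'cV[rat]_n) :
  let L := reduced_laplacian G v in
  let M := reduced_laplacian (all_positive G) v in
  let s := sink_vector G q v in
  Splus L M c ->
  critical L M c <-> stab L M (c + L *m invmx M *m s) = c.
Proof.
move=> L M s Sc; have LM := laplacian_pair v_inj v_nonsink G_conn.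
rewrite /s -(positive_laplacian1 G v_inj v_nonsink) mulmxA mulmxKV.
  exact: critical_iff_stab.
exact: (pair_M_unit LM).
Qed.
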